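(* The Jordan algebras $\mathcal{J}^3_1$, $\mathbb{C}\times\mathcal{J}^2_0$, $\mathcal{E}_2$, $\mathcal{E}_3$, $\mathcal{E}_4$ and $\mathcal{J}^3_0$ have no embeddings into $\mathbb{S}^3$. Every embedding of $\mathcal{E}_1$ into $\mathbb{S}^3$ is congruent to $$E^{(1)}_3:=\left\{\begin{pmatrix}v&w&x\\ w&y&0\\ x&0&0\end{pmatrix}\,\middle|\,v,w,x,y\in\mathbb{C}\right\}.$$
   Context: $\mathbb{S}^n$ is the space of complex symmetric $n\times n$ matrices. A (unital) Jordan algebra is a complex vector space with a symmetric bilinear product satisfying $(x\cdot x)\cdot(x\cdot y)=x\cdot((x\cdot x)\cdot y)$ for all $x,y$ and having a unit; morphisms are linear maps preserving products and units. For an invertible $U\in\mathbb{S}^n$, the product $X\bullet_U Y=\frac12(XU^{-1}Y+YU^{-1}X)$ makes $\mathbb{S}^n$ a unital Jordan algebra with unit $U$. An embedding of a Jordan algebra $\mathcal{A}$ into $\mathbb{S}^n$ is the image of an injective morphism of unital Jordan algebras $\mathcal{A}\to(\mathbb{S}^n,\bullet_U)$ for some invertible $U\in\mathbb{S}^n$. Two subspaces $\mathcal{L},\mathcal{L}'\subseteq\mathbb{S}^n$ are congruent if $\mathcal{L}'=P\mathcal{L}P^\top$ for some $P\in\mathrm{GL}_n(\mathbb{C})$. For integers $d\ge1$, $0\le r\le d$, $\mathcal{J}^d_r$ is the Jordan algebra $\mathbb{C}\times\mathbb{C}^d$ with product $(\lambda,v)\cdot(\mu,w)=(\lambda\mu+\beta(v,w),\lambda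 w+\mu v)$, where $\beta(v,w)=v_1w_1+\dots+v_rw_r$. Products of Jordan algebras carry the componentwise product. The $4$-dimensional Jordan algebras $\mathcal{E}_i$ are given by the following (commutative) multiplication tables. - $\mathcal{E}_1$: basis $X,Y,V,W$ with unit $X+Y$ and $X^2=X$, $XY=0$, $XV=V$, $XW=\frac12W$, $Y^2=Y$, $YV=0$, $YW=\frac12W$, $V^2=0$, $VW=0$, $W^2=V$. - $\mathcal{E}_2$: the same table as $\mathcal{E}_1$ except that $W^2=0$. - $\mathcal{E}_3$: basis $U,X,Y,Z$ with unit $U$, $X^2=Y$, $Z^2=Y$, and $XY=XZ=Y^2=YZ=0$. - $\mathcal{E}_4=\mathbb{C}[x,y]/(x^3,xy,y^2)$: basis $U,X,Y,Z$ with unit $U$, $X^2=Y$, and $XY=XZ=Y^2=YZ=Z^2=0$. *)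

(* Defs.v *)
From HB Require Import structures.
From mathcomp Require Import all_boot all_order all_algebra ring.
From mathcomp Require Import all_classical reals.
From mathcomp.real_closed Require Export complex.

Set Implicit Arguments.
Unset Strict Implicit.
Unset Printing Implicit Defensive.

Import Order.TTheory GRing.Theory Num.Theory.
Local Open Scope ring_scope.

(** Everything is developed over an arbitrary numeric field [F]; the theorem
    uses [F := R[i]] with [R] a [realType], i.e. the field of complex numbers. *)

(** Unital Jordan algebras.  Linearity in the first argument and commutativity
    together give bilinearity. *)
Record jordanAlgebra (F : numFieldType) := JordanAlgebra {
  jordan_sort :> lmodType F;
  jmul : jordan_sort -> jordan_sort -> jordan_sort;
  jone : jordan_sort;
  jmulC : commutative jmul;
  jmul_linearl : forall y, linear (jmul ^~ y);
  jmul_jordan : forall x y,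
    jmul (jmul x x) (jmul x y) = jmul x (jmul (jmul x x) y);
  jmul1 : left_id jone jmul
}.

Definition jordan_morphism (F : numFieldType) (A B : jordanAlgebra F)
    (f : A -> B) : Prop :=
  [/\ linear f, {morph f : x y / jmul x y} & f (jone A) = jone B].

Section SymmetricMatrices.
Variables (F : numFieldType) (n : nat).

Definition symmx_pred : {pred 'M[F]_n} := fun M => M \is symmetricmx.

Lemma symmx_predP M : reflect (M^T = M) (M \in symmx_pred).
Proof.
rewrite unfold_in is_hermitianmxE expr0 scale1r map_mx_id //.
by apply: (iffP eqP) => [{2}->|->].
Qed.

Fact symmx_submod_closed : submod_closed symmx_pred.
Proof.
split=> [|a A B /symmx_predP hA /symmx_predP hB]; apply/symmx_predP.
  by rewrite trmx0.
by rewrite linearP /= hA hB.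
Qed.

HB.instance Definition _ :=
  GRing.isSubmodClosed.Build F 'M[F]_n symmx_pred symmx_submod_closed.

Record symmx := SymMx { symmx_val :> 'M[F]_n; _ : symmx_val \in symmx_pred }.

HB.instance Definition _ := [isSub for symmx_val].
HB.instance Definition _ := [Choice of symmx by <:].
HB.instance Definition _ := [SubChoice_isSubLmodule of symmx by <:].

Lemma symmx_tr (X : symmx) : X^T = X.
Proof. exact/symmx_predP/(valP X). Qed.

Definition bullet_mx (U X Y : 'M[F]_n) : 'M[F]_n :=
  2^-1 *: (X *m invmx U *m Y + Y *m invmx U *m X).

Fact bullet_sym (U X Y : symmx) : bullet_mx U X Y \in symmx_pred.
Proof.
apply/symmx_predP; rewrite /bullet_mx linearZ linearD /= !trmx_mul trmx_inv.
by rewrite !symmx_tr !mulmxA addrC.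
Qed.

Definition bullet (U X Y : symmx) : symmx := SymMx (bullet_sym U X Y).

Section Bullet.
Variables (U : symmx) (hU : symmx_val U \in unitmx).

Fact bulletC : commutative (bullet U).
Proof. by move=> X Y; apply: val_inj; congr (_ *: _); apply: addrC. Qed.

Fact bullet_linearl Y : linear (bullet U ^~ Y).
Proof.
move=> a X Z; apply: val_inj; rewrite /= /bullet_mx.
rewrite !mulmxDl !mulmxDr -!(scalemxAl, scalemxAr) addrACA -scalerDr.
by rewrite [LHS]scalerDr !scalerA (mulrC a).
Qed.

Fact bullet_sqr (X : 'M[F]_n) : bullet_mx U X X = X *m invmx U *m X.
Proof. by rewrite /bullet_mx -mulr2n -scaler_nat scalerA mulVf ?pnatr_eq0 ?scale1r. Qed.

Fact bullet_jordan X Y :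
  bullet U (bullet U X X) (bullet U X Y) =
  bullet U X (bullet U (bullet U X X) Y).
Proof.
apply: val_inj; rewrite /= bullet_sqr /bullet_mx.
rewrite -!(scalemxAl, scalemxAr) -!scalerDr; congr (_ *: (_ *: _)).
rewrite !mulmxDl !mulmxDr !mulmxA !addrA; congr (_ + _).
by rewrite addrAC -!addrA; congr (_ + _); rewrite addrC.
Qed.

Fact bullet1 : left_id U (bullet U).
Proof.
move=> X; apply: val_inj; rewrite /= /bullet_mx mulmxV // mul1mx mulmxKV //.
by rewrite -mulr2n -scaler_nat scalerA mulVf ?pnatr_eq0 ?scale1r.
Qed.

Definition sym_jordan : jordanAlgebra F :=
  JordanAlgebra bulletC bullet_linearl bullet_jordan bullet1.

End Bullet.
End SymmetricMatrices.

Definition is_embedding (F : numFieldType) (n : nat) (A : jordanAlgebra F)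
    (L : set 'M[F]_n) : Prop :=
  exists (U : symmx F n) (hU : symmx_val U \in unitmx) (f : A -> sym_jordan hU),
    [/\ jordan_morphism f, injective f & L = range (fun a => symmx_val (f a))].

Definition congruent (F : numFieldType) (n : nat) (L L' : set 'M[F]_n) : Prop :=
  exists2 P : 'M[F]_n, P \in unitmx &
    L' = ((fun X => P *m X *m P^T) @` L)%classic.

Section Spin.
Variables (F : numFieldType) (d r : nat).

Definition spin_form (v w : 'rV[F]_d) : F := \sum_(i < d | (i < r)%N) v 0 i * w 0 i.

Definition spin_mul (x y : F^o * 'rV[F]_d) : F^o * 'rV[F]_d :=
  (x.1 * y.1 + spin_form x.2 y.2, x.1 *: y.2 + y.1 *: x.2).

Fact spin_formC : commutative spin_form.
Proof. by move=> v w; apply: eq_bigr => i _; rewrite mulrC. Qed.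

Fact spin_form_linearl w : scalar (spin_form ^~ w).
Proof.
move=> a u v; rewrite /spin_form mulr_sumr -big_split /=.
by apply: eq_bigr => i _; rewrite !mxE mulrDl mulrA.
Qed.

Fact spin_mulC : commutative spin_mul.
Proof. by move=> x y; rewrite /spin_mul spin_formC mulrC addrC [_ + _ *: x.2]addrC. Qed.

Fact spin_mul_linearl y : linear (spin_mul ^~ y).
Proof.
move=> a x z; rewrite /spin_mul /=; congr (_, _) => /=.
  by rewrite spin_form_linearl /GRing.scale /=; ring.
by apply/rowP => j; rewrite !mxE /GRing.scale /=; ring.
Qed.

Fact spin_mul_jordan x y :
  spin_mul (spin_mul x x) (spin_mul x y) = spin_mul x (spin_mul (spin_mul x x) y).
Proof.
have Dl u v w : spin_form (u + v) w = spin_form u w + spin_form v w.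
  by rewrite -{1}[u]scale1r spin_form_linearl mul1r.
have Zl a u w : spin_form (a *: u) w = a * spin_form u w.
  have f0 : spin_form 0 w = 0 by apply: big1 => i _; rewrite mxE mul0r.
  by rewrite -[a *: u]addr0 spin_form_linearl f0 addr0.
have Dr w u v : spin_form w (u + v) = spin_form w u + spin_form w v.
  by rewrite spin_formC Dl !(spin_formC w).
have Zr w a u : spin_form w (a *: u) = a * spin_form w u.
  by rewrite spin_formC Zl (spin_formC w).
rewrite /spin_mul /=; congr (_, _) => /=.
  by rewrite !(Dl, Dr, Zl, Zr) (spin_formC x.2 y.2); ring.
by apply/rowP => j; rewrite !mxE !(Dl, Dr, Zl, Zr) /GRing.scale /=; ring.
Qed.

Fact spin_mul1 : left_id (1, 0) spin_mul.
Proof.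
move=> [a v]; rewrite /spin_mul /= mul1r scale1r scaler0 addr0.
by rewrite /spin_form big1 ?addr0 // => i _; rewrite mxE mul0r.
Qed.

(** The algebra $\mathcal{J}^d_r$, meaningful for [1 <= d] and [r <= d]. *)
Definition spin_jordan : jordanAlgebra F :=
  JordanAlgebra spin_mulC spin_mul_linearl spin_mul_jordan spin_mul1.

End Spin.

Section BaseField.
Variable F : numFieldType.

Fact base_mul_linearl (y : F^o) : linear (fun x : F^o => x * y : F^o).
Proof. by move=> a x z; rewrite mulrDl scalerAl. Qed.

Fact base_mul_jordan (x y : F^o) : (x * x) * (x * y) = x * ((x * x) * y).
Proof. by rewrite !mulrA. Qed.

Definition base_jordan : jordanAlgebra F :=
  @JordanAlgebra F F^o *%R 1 (@mulrC F) base_mul_linearl base_mul_jordan (@mul1r F).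

End BaseField.

Section Product.
Variables (F : numFieldType) (A B : jordanAlgebra F).

Definition prod_mul (x y : A * B) : A * B := (jmul x.1 y.1, jmul x.2 y.2).

Fact prod_mulC : commutative prod_mul.
Proof. by move=> x y; rewrite /prod_mul jmulC [jmul x.2 _]jmulC. Qed.

Fact prod_mul_linearl y : linear (prod_mul ^~ y).
Proof. by move=> a x z; rewrite /prod_mul /= !jmul_linearl. Qed.

Fact prod_mul_jordan x y :
  prod_mul (prod_mul x x) (prod_mul x y) = prod_mul x (prod_mul (prod_mul x x) y).
Proof. by rewrite /prod_mul /= !jmul_jordan. Qed.

Fact prod_mul1 : left_id (jone A, jone B) prod_mul.
Proof. by move=> [x y]; rewrite /prod_mul /= !jmul1. Qed.

Definition prod_jordan : jordanAlgebra F :=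
  JordanAlgebra prod_mulC prod_mul_linearl prod_mul_jordan prod_mul1.

End Product.

Section Tables.
Variable F : numFieldType.

Definition basis4 (k : nat) : 'rV[F]_4 := \row_(j < 4) (val j == k)%:R.
Local Notation "''b_' k" := (basis4 k) (at level 8, k at level 2).

(** The bilinear product on coordinate vectors whose value on the [i]-th and
    [j]-th basis vectors is [T i j]. *)
Definition table_mul (T : nat -> nat -> 'rV[F]_4) (x y : 'rV[F]_4) : 'rV[F]_4 :=
  \sum_(i < 4) \sum_(j < 4) (x 0 i * y 0 j) *: T i j.

Fact table_mul_linearl T y : linear (table_mul T ^~ y).
Proof.
move=> a x z; rewrite /table_mul scaler_sumr -big_split /=.
apply: eq_bigr => i _; rewrite scaler_sumr -big_split /=.
by apply: eq_bigr => j _; rewrite !mxE mulrDl scalerDl scalerA mulrA.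
Qed.

(* basis X, Y, V, W *)
Definition E1_table (i j : nat) : 'rV[F]_4 :=
  let X := 'b_0 in let Y := 'b_1 in let V := 'b_2 in let W := 'b_3 in
  match i, j with
  | 0, 0 => X
  | 0, 2 | 2, 0 => V
  | 0, 3 | 3, 0 => 2^-1 *: W
  | 1, 1 => Y
  | 1, 3 | 3, 1 => 2^-1 *: W
  | 3, 3 => V
  | _, _ => 0
  end.

(* basis X, Y, V, W *)
Definition E2_table (i j : nat) : 'rV[F]_4 :=
  match i, j with
  | 3, 3 => 0
  | _, _ => E1_table i j
  end.

(* basis U, X, Y, Z *)
Definition E3_table (i j : nat) : 'rV[F]_4 :=
  let Y := 'b_2 in
  match i, j with
  | 0, k | k, 0 => 'b_k
  | 1, 1 => Y
  | 3, 3 => Y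
  | _, _ => 0
  end.

(* basis U, X, Y, Z *)
Definition E4_table (i j : nat) : 'rV[F]_4 :=
  match i, j with
  | 3, 3 => 0
  | _, _ => E3_table i j
  end.

Lemma table_mulE T x y k : table_mul T x y 0 k =
  \sum_(i < 4) \sum_(j < 4) x 0 i * y 0 j * T i j 0 k.
Proof.
rewrite summxE; apply: eq_bigr => i _; rewrite summxE.
by apply: eq_bigr => j _; rewrite mxE.
Qed.

Fact table_mulC T : (forall i j, T i j = T j i) -> commutative (table_mul T).
Proof.
move=> TC x y; rewrite /table_mul exchange_big /=.
by apply: eq_bigr => i _; apply: eq_bigr => j _; rewrite TC mulrC.
Qed.

Local Definition o0 : 'I_4 := @Ordinal 4 0 isT.
Local Definition o1 : 'I_4 := @Ordinal 4 1 isT.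
Local Definition o2 : 'I_4 := @Ordinal 4 2 isT.
Local Definition o3 : 'I_4 := @Ordinal 4 3 isT.

Local Fact sum4 (f : 'I_4 -> F) : \sum_i f i = f o0 + f o1 + f o2 + f o3.
Proof.
rewrite !big_ord_recl big_ord0 addr0 !addrA.
by congr (f _ + f _ + f _ + f _); apply: val_inj.
Qed.

Local Fact row4P (x y : 'rV[F]_4) : x 0 o0 = y 0 o0 -> x 0 o1 = y 0 o1 ->
  x 0 o2 = y 0 o2 -> x 0 o3 = y 0 o3 -> x = y.
Proof.
move=> h0 h1 h2 h3; apply/rowP => -[[|[|[|[|//]]]] hi].
- by rewrite (_ : Ordinal hi = o0) //; apply: val_inj.
- by rewrite (_ : Ordinal hi = o1) //; apply: val_inj.
- by rewrite (_ : Ordinal hi = o2) //; apply: val_inj.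
- by rewrite (_ : Ordinal hi = o3) //; apply: val_inj.
Qed.

Local Fact E1_mulE (x y : 'rV[F]_4) : let m := table_mul E1_table x y in
  [/\ m 0 o0 = x 0 o0 * y 0 o0, m 0 o1 = x 0 o1 * y 0 o1,
      m 0 o2 = x 0 o0 * y 0 o2 + x 0 o2 * y 0 o0 + x 0 o3 * y 0 o3 &
      m 0 o3 = ((x 0 o0 + x 0 o1) * y 0 o3 + x 0 o3 * (y 0 o0 + y 0 o1)) / 2].
Proof. by move=> m; rewrite /m; split; rewrite table_mulE !sum4 /= !mxE /=; field. Qed.

Local Fact E2_mulE (x y : 'rV[F]_4) : let m := table_mul E2_table x y in
  [/\ m 0 o0 = x 0 o0 * y 0 o0, m 0 o1 = x 0 o1 * y 0 o1,
      m 0 o2 = x 0 o0 * y 0 o2 + x 0 o2 * y 0 o0 &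
      m 0 o3 = ((x 0 o0 + x 0 o1) * y 0 o3 + x 0 o3 * (y 0 o0 + y 0 o1)) / 2].
Proof. by move=> m; rewrite /m; split; rewrite table_mulE !sum4 /= !mxE /=; field. Qed.

Local Fact E3_mulE (x y : 'rV[F]_4) : let m := table_mul E3_table x y in
  [/\ m 0 o0 = x 0 o0 * y 0 o0, m 0 o1 = x 0 o0 * y 0 o1 + x 0 o1 * y 0 o0,
      m 0 o2 = x 0 o0 * y 0 o2 + x 0 o2 * y 0 o0 + x 0 o1 * y 0 o1 + x 0 o3 * y 0 o3 &
      m 0 o3 = x 0 o0 * y 0 o3 + x 0 o3 * y 0 o0].
Proof. by move=> m; rewrite /m; split; rewrite table_mulE !sum4 /= !mxE /=; ring. Qed.

Local Fact E4_mulE (x y : 'rV[F]_4) : let m := table_mul E4_table x y in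
  [/\ m 0 o0 = x 0 o0 * y 0 o0, m 0 o1 = x 0 o0 * y 0 o1 + x 0 o1 * y 0 o0,
      m 0 o2 = x 0 o0 * y 0 o2 + x 0 o2 * y 0 o0 + x 0 o1 * y 0 o1 &
      m 0 o3 = x 0 o0 * y 0 o3 + x 0 o3 * y 0 o0].
Proof. by move=> m; rewrite /m; split; rewrite table_mulE !sum4 /= !mxE /=; ring. Qed.

Fact E1_tableC i j : E1_table i j = E1_table j i.
Proof. by case: i => [|[|[|[|i]]]]; case: j => [|[|[|[|j]]]]. Qed.

Fact E2_tableC i j : E2_table i j = E2_table j i.
Proof. by case: i => [|[|[|[|i]]]]; case: j => [|[|[|[|j]]]]. Qed.

Fact E3_tableC i j : E3_table i j = E3_table j i.
Proof. by case: i => [|[|[|[|i]]]]; case: j => [|[|[|[|j]]]]. Qed.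

Fact E4_tableC i j : E4_table i j = E4_table j i.
Proof. by case: i => [|[|[|[|i]]]]; case: j => [|[|[|[|j]]]]. Qed.

Local Notation jordan_identity T := (forall x y,
  table_mul T (table_mul T x x) (table_mul T x y) =
  table_mul T x (table_mul T (table_mul T x x) y)).

Fact E1_jordan : jordan_identity E1_table.
Proof.
have h0 x y := let: And4 h _ _ _ := E1_mulE x y in h.
have h1 x y := let: And4 _ h _ _ := E1_mulE x y in h.
have h2 x y := let: And4 _ _ h _ := E1_mulE x y in h.
have h3 x y := let: And4 _ _ _ h := E1_mulE x y in h.
by move=> x y; apply: row4P; rewrite !(h0, h1, h2, h3); field.
Qed.

Fact E2_jordan : jordan_identity E2_table.
Proof.
have h0 x y := let: And4 h _ _ _ := E2_mulE x y in h.
have h1 x y := let: And4 _ h _ _ := E2_mulE x y in h.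
have h2 x y := let: And4 _ _ h _ := E2_mulE x y in h.
have h3 x y := let: And4 _ _ _ h := E2_mulE x y in h.
by move=> x y; apply: row4P; rewrite !(h0, h1, h2, h3); field.
Qed.

Fact E3_jordan : jordan_identity E3_table.
Proof.
have h0 x y := let: And4 h _ _ _ := E3_mulE x y in h.
have h1 x y := let: And4 _ h _ _ := E3_mulE x y in h.
have h2 x y := let: And4 _ _ h _ := E3_mulE x y in h.
have h3 x y := let: And4 _ _ _ h := E3_mulE x y in h.
by move=> x y; apply: row4P; rewrite !(h0, h1, h2, h3); ring.
Qed.

Fact E4_jordan : jordan_identity E4_table.
Proof.
have h0 x y := let: And4 h _ _ _ := E4_mulE x y in h.
have h1 x y := let: And4 _ h _ _ := E4_mulE x y in h.
have h2 x y := let: And4 _ _ h _ := E4_mulE x y in h.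
have h3 x y := let: And4 _ _ _ h := E4_mulE x y in h.
by move=> x y; apply: row4P; rewrite !(h0, h1, h2, h3); ring.
Qed.

Fact E1_mul1 : left_id ('b_0 + 'b_1) (table_mul E1_table).
Proof.
by move=> x; have [h0 h1 h2 h3] := E1_mulE ('b_0 + 'b_1) x; apply: row4P;
  rewrite (h0, h1, h2, h3) !mxE /=; field.
Qed.

Fact E2_mul1 : left_id ('b_0 + 'b_1) (table_mul E2_table).
Proof.
by move=> x; have [h0 h1 h2 h3] := E2_mulE ('b_0 + 'b_1) x; apply: row4P;
  rewrite (h0, h1, h2, h3) !mxE /=; field.
Qed.

Fact E3_mul1 : left_id 'b_0 (table_mul E3_table).
Proof.
by move=> x; have [h0 h1 h2 h3] := E3_mulE 'b_0 x; apply: row4P;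
  rewrite (h0, h1, h2, h3) !mxE /=; ring.
Qed.

Fact E4_mul1 : left_id 'b_0 (table_mul E4_table).
Proof.
by move=> x; have [h0 h1 h2 h3] := E4_mulE 'b_0 x; apply: row4P;
  rewrite (h0, h1, h2, h3) !mxE /=; ring.
Qed.

Definition E1_jordanAlgebra : jordanAlgebra F :=
  JordanAlgebra (table_mulC E1_tableC) (table_mul_linearl E1_table)
    E1_jordan E1_mul1.

Definition E2_jordanAlgebra : jordanAlgebra F :=
  JordanAlgebra (table_mulC E2_tableC) (table_mul_linearl E2_table)
    E2_jordan E2_mul1.

Definition E3_jordanAlgebra : jordanAlgebra F :=
  JordanAlgebra (table_mulC E3_tableC) (table_mul_linearl E3_table)
    E3_jordan E3_mul1.

Definition E4_jordanAlgebra : jordanAlgebra F :=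
  JordanAlgebra (table_mulC E4_tableC) (table_mul_linearl E4_table)
    E4_jordan E4_mul1.

End Tables.

Definition E1_3_mx (F : numFieldType) (v w x y : F) : 'M[F]_3 :=
  \matrix_(i, j) nth 0 (nth [::] [:: [:: v; w; x];
                                     [:: w; y; 0];
                                     [:: x; 0; 0]] i) j.

(** The subspace $E^{(1)}_3$. *)
Definition E1_3 (F : numFieldType) : set 'M[F]_3 :=
  [set M | exists v w x y : F, M = E1_3_mx v w x y]%classic.
Arguments E1_3 : clear implicits.

(* Main.v *)
Require Import Defs.
From HB Require Import structures.
From mathcomp Require Import all_boot all_order all_algebra ring.
From mathcomp Require Import all_classical reals.

(** Put [K := U^-1].  An embedding sends [a] to a symmetric matrix [g a], and
    [g a *m K] is an operator on column vectors that is self-adjoint for the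
    nondegenerate form [s^T *m K *m t]; Jordan products become anticommutators
    of these operators.

    Non-embeddability.  In each of the six algebras one finds a null plane, that
    is, two independent elements [a], [b] with [a^2 = ab = b^2 = 0].  Every
    element [X] of the image of the plane satisfies [X K X = 0], so
    [2 \rank X <= 3] and [X] has rank at most one.  But a linear space of
    symmetric matrices of rank at most one has dimension at most one
    ([sym_rank1_pencil]), which contradicts injectivity
    ([null_plane_no_embedding]).  The only algebra whose null plane is not
    visible in its table is the one with [X^2 = Z^2 = Y] and [XZ = 0]: there the
    plane is spanned by [Y] and [X + iZ], so a square root of -1 is needed.

    Uniqueness for the algebra with [W^2 = V].  Let [A], [B], [N] be the
    operators of [X], [V], [W].  The table makes [A] idempotent, [N] exchange
    the image and the kernel of [A], and [N^2 = B] nonzero with [N^3 = 0].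
    Thus [N] is a single Jordan block, and a vector [t] in the image of [A] with
    [N^2 t] nonzero gives a basis [N^2 t, N t, t].  By self-adjointness the Gram
    matrix of that basis is antidiagonal, once [t] is corrected by a multiple of
    [N^2 t] so as to be isotropic ([E1_adapted_frame]).  In that basis both the
    operators and the form are explicit, and if [Q] is the matrix of the basis
    then [Q^-1] is the required congruence ([E1_normal_form]). *)

Set Implicit Arguments.
Unset Strict Implicit.
Unset Printing Implicit Defensive.
Import Order.TTheory GRing.Theory Num.Theory.
Local Open Scope ring_scope.

(** * Symmetric matrices of rank at most one *)

Lemma rank1_minor (F : fieldType) (m n : nat) (A : 'M[F]_(m, n)) i j k l :
  (\rank A <= 1)%N -> A i j * A k l = A i l * A k j.
Proof.
rewrite -{2 3 4 5}(mulmx_base A).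
move: (col_base A) (row_base A); case: (\rank A) => [|[|//]] C D _.
  by rewrite !mxE !big_ord0 !mul0r.
by rewrite !mxE !big_ord1; ring.
Qed.

Lemma null_rank (F : fieldType) (n : nat) (K X : 'M[F]_n) :
  K \in unitmx -> X *m K *m X = 0 -> (\rank X + \rank X <= n)%N.
Proof.
move=> Ku /mulmx0_rank_max; rewrite mxrankMfree //.
by rewrite row_free_unit.
Qed.

(** A nonzero symmetric [X] of rank one has a nonzero diagonal entry [X k k].
    Subtracting from [Y] the multiple of [X] that clears the entry [(k, k)]
    leaves a matrix whose whole [k]-th row and column vanish, because its 2x2
    minors do; the minors of its sum with [X] then force it to be zero. *)
Lemma sym_rank1_pencil (F : fieldType) (n : nat) (X Y : 'M[F]_n) :
  X^T = X -> Y^T = Y -> (forall a b, \rank (a *: X + b *: Y)%R <= 1)%N -> X != 0 ->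
  exists c, Y = c *: X.
Proof.
move=> Xs Ys XYr X0.
have minor a b i j k l := rank1_minor i j k l (XYr a b).
have sX i j : X i j = X j i by rewrite -{1}Xs mxE.
have sY i j : Y i j = Y j i by rewrite -{1}Ys mxE.
have [k Xk0] : exists k, X k k != 0.
  have [i [j Xij]] : exists i j, X i j != 0.
    apply: contrapT => h; move: X0; rewrite (_ : X = 0) ?eqxx //.
    apply/matrixP => i j; rewrite mxE; apply/eqP/negPn/negP => Xij.
    by apply: h; exists i, j.
  exists i; apply: contraNneq Xij => Xii.
  move: (minor 1 0 i i j j); rewrite !mxE !mul1r !mul0r !addr0 Xii mul0r (sX j i).
  by move/esym/eqP; rewrite mulf_eq0 orbb.
exists (Y k k / X k k); set c := Y k k / X k k.
(* the minor of Y - c X on rows and columns i, k is minus the square of its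
   entry (i, k) *)
have Zik i : Y i k = c * X i k.
  have := minor (- c) 1 i i k k; rewrite !mxE !mul1r (sX k i) (sY k i).
  rewrite (mulNr c (X k k)) divfK // addNr mulr0 => /esym/eqP.
  by rewrite mulf_eq0 orbb mulNr addrC subr_eq0 => /eqP.
apply/matrixP => i j; rewrite mxE; apply: (mulIf Xk0).
have X_ := minor 1 0 i j k k; have XZ := minor (1 - c) 1 i j k k.
move: X_ XZ; rewrite !mxE !mul1r !mul0r !addr0 (sX k j) (sY k j) !Zik => X_ XZ.
transitivity (((1 - c) * X i j + Y i j) * ((1 - c) * X k k + c * X k k)
              - (1 - c) * (X i j * X k k)); first by ring.
by rewrite XZ -[RHS]mulrA X_; ring.
Qed.

(** Polarization. *)
Lemma sym_form_neq0 (F : numFieldType) (n : nat) (M : 'M[F]_n) :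
  M^T = M -> M != 0 -> exists s : 'cV[F]_n, (s^T *m M *m s) 0 0 != 0.
Proof.
move=> Ms M0; apply: contrapT => h; case/negP: M0; apply/eqP.
have q (s : 'cV[F]_n) : (s^T *m M *m s) 0 0 = 0.
  by apply/eqP/negPn/negP => s0; apply: h; exists s.
have E i j : M i j = ((delta_mx i 0 : 'cV[F]_n)^T *m M *m (delta_mx j 0 : 'cV[F]_n)) 0 0.
  by rewrite trmx_delta -rowE -colE !mxE.
apply/matrixP => i j; rewrite mxE.
have sM : M j i = M i j by rewrite -[in LHS]Ms mxE.
have D (A B : 'M[F]_1) : (A + B) 0 0 = A 0 0 + B 0 0 by rewrite mxE.
have := q (delta_mx i 0 + delta_mx j 0).
rewrite [(_ + _)^T]raddfD /= !mulmxDl !mulmxDr.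
rewrite !D !q -!E sM add0r addr0 -mulr2n.
by move/eqP; rewrite mulrn_eq0 => /eqP.
Qed.

(** * Embeddings in terms of matrices *)

Lemma embeddingP (F : numFieldType) (n : nat) (A : jordanAlgebra F) (L : set 'M[F]_n) :
  is_embedding A L ->
  exists (U : 'M[F]_n) (g : {linear A -> 'M[F]_n}),
    [/\ [/\ U \in unitmx, U^T = U & g (jone A) = U], injective g,
        forall a, (g a)^T = g a,
        forall a b, g a *m invmx U *m g b + g b *m invmx U *m g a
                    = 2 *: g (jmul a b)
      & L = range g].
Proof.
move=> [U [hU [f [[flin fM f1] finj ->]]]].
have glin : linear (fun a => symmx_val (f a)) by move=> c a b; rewrite flin.
pose g : {linear A -> 'M[F]_n} := HB.pack (fun a => symmx_val (f a))
  (GRing.isLinear.Build _ _ _ _ (fun a => symmx_val (f a)) glin).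
exists (symmx_val U), g; split=> //.
- by split=> //; [apply: symmx_tr | rewrite /g /= f1].
- by move=> a b /val_inj/finj.
- by move=> a; apply: symmx_tr.
- move=> a b; rewrite /g /= fM /= /bullet_mx scalerA mulfV ?pnatr_eq0 //.
  by rewrite scale1r.
Qed.

(** * Coordinates in the algebras given by tables *)

Lemma basis4_mul (F : numFieldType) T (i j : nat) : (i < 4)%N -> (j < 4)%N ->
  table_mul T (basis4 F i) (basis4 F j) = T i j.
Proof.
move=> hi hj; rewrite /table_mul (bigD1 (Ordinal hi)) //=
  [X in X + _](bigD1 (Ordinal hj)) //=.
rewrite !mxE /= !eqxx mulr1 scale1r.
rewrite big1 ?addr0 => [|k kj]; last first.
  by rewrite !mxE (negbTE (kj : val k != j)) mulr0 scale0r.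
rewrite big1 ?addr0 // => k ki; apply: big1 => l _.
by rewrite !mxE (negbTE (ki : val k != i)) mul0r scale0r.
Qed.

Lemma basis4_expansion (F : numFieldType) (a : 'rV[F]_4) :
  a = a 0 0 *: basis4 F 0 + a 0 1 *: basis4 F 1
      + a 0 2 *: basis4 F 2 + a 0 3 *: basis4 F 3.
Proof.
apply/rowP => -[[|[|[|[|//]]]] hi]; rewrite !mxE /= ?(mulr0, mulr1, addr0, add0r);
  by congr (a 0 _); apply: val_inj.
Qed.

Lemma basis4_neq0 (F : numFieldType) (i : nat) : (i < 4)%N -> basis4 F i != 0.
Proof.
move=> hi; apply/eqP => /rowP/(_ (Ordinal hi))/eqP.
by rewrite !mxE eqxx oner_eq0.
Qed.

Lemma basis4_indep (F : numFieldType) (i j : nat) (c : F) :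
  (j < 4)%N -> i != j -> basis4 F j != c *: basis4 F i.
Proof.
move=> hj ij; apply/eqP => /rowP/(_ (Ordinal hj))/eqP.
by rewrite !mxE eqxx /= (eq_sym j) (negbTE ij) mulr0 oner_eq0.
Qed.

(** * Null planes obstruct embeddings *)

(** This is where the size 3 enters: square-zero matrices of size 3 have rank at
    most one, while those of size 4 can have rank two. *)
Lemma null_elements_dependent (F : numFieldType) (A : jordanAlgebra F)
    (L : set 'M[F]_3) (a b : A) :
  is_embedding A L -> jmul a a = 0 -> jmul a b = 0 -> jmul b b = 0 -> a != 0 ->
  exists c, b = c *: a.
Proof.
move=> /embeddingP[U [g [[Uu _ _] ginj gs gM _]]] aa ab bb a0.
have Ku : invmx U \in unitmx by rewrite unitmx_inv.
have null x y : jmul x y = 0 -> g x *m invmx U *m g y + g y *m invmx U *m g x = 0.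
  by move=> xy; rewrite gM xy linear0 scaler0.
have sq0 x : jmul x x = 0 -> g x *m invmx U *m g x = 0.
  move=> /null; rewrite -mulr2n -scaler_nat => /eqP.
  by rewrite scaler_eq0 pnatr_eq0 => /eqP.
have [||s t||c gb] := @sym_rank1_pencil F 3 (g a) (g b).
- exact: gs.
- exact: gs.
- have : (\rank (s *: g a + t *: g b)%R + \rank (s *: g a + t *: g b)%R <= 3)%N.
    apply: (null_rank Ku); rewrite !mulmxDl !mulmxDr -!(scalemxAl, scalemxAr).
    rewrite !sq0 // !scaler0 add0r addr0 !scalerA (mulrC t) -scalerDr.
    by rewrite null // scaler0.
  by case: (\rank _) => [|[|k]] //; rewrite !addSn !addnS.
- apply: contraNneq a0 => ga0; apply/eqP/ginj; rewrite ga0.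
  by rewrite linear0.
- by exists c; apply: ginj; rewrite linearZ.
Qed.

Definition has_null_plane (F : numFieldType) (A : jordanAlgebra F) :=
  exists a b : A, [/\ jmul a a = 0, jmul a b = 0 & jmul b b = 0] /\
                  (a != 0 /\ forall c, b != c *: a).

Lemma null_plane_no_embedding (F : numFieldType) (A : jordanAlgebra F) (L : set 'M[F]_3) :
  has_null_plane A -> ~ is_embedding A L.
Proof.
move=> [a [b [[aa ab bb] [a0 ba]]]] AL.
by have [c /eqP] := null_elements_dependent AL aa ab bb a0; apply/negP.
Qed.

(** The basis vectors with index at least [r] span the radical of the form, and
    there are at least two of them. *)
Lemma spin_null_plane (F : numFieldType) (d r : nat) :
  (r.+2 <= d)%N -> has_null_plane (spin_jordan F d r).
Proof.
move=> rd; pose i := Ordinal (ltnW rd); pose j := Ordinal rd.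
have null (v w : 'rV[F]_d) : (forall l : 'I_d, (l < r)%N -> v 0 l = 0) ->
    spin_mul r (0, v) (0, w) = 0.
  move=> v0; rewrite /spin_mul /= /spin_form mul0r !scale0r add0r addr0 big1 //.
  by move=> l lr; rewrite v0 // mul0r.
have rad (k : 'I_d) (l : 'I_d) : (r <= k)%N -> (l < r)%N ->
    (delta_mx 0 k : 'rV[F]_d) 0 l = 0.
  move=> rk lr; rewrite mxE eqxx /=; case: eqP lr => // ->.
  by rewrite ltnNge rk.
exists (0, delta_mx 0 i), (0, delta_mx 0 j); split; first split.
- by apply: null => l; apply: rad => /=.
- by apply: null => l; apply: rad => /=.
- by apply: null => l; apply: rad => /=.
split=> [|c]; apply/eqP.
  by move=> [] /rowP/(_ i)/eqP; rewrite !mxE !eqxx oner_eq0.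
move=> [] _ /rowP/(_ j)/eqP; rewrite !mxE !eqxx /= (_ : j == i = false)
  ?mulr0 ?oner_eq0 //.
by apply/negbTE; rewrite -val_eqE /= eqn_leq ltnn.
Qed.

Lemma jmul0 (F : numFieldType) (A : jordanAlgebra F) (x : A) : jmul 0 x = 0.
Proof.
by have := jmul_linearl x (-1) 0 0; rewrite !scaleN1r oppr0 addr0 addNr.
Qed.

Lemma jmulDl (F : numFieldType) (A : jordanAlgebra F) (x y z : A) :
  jmul (x + y) z = jmul x z + jmul y z.
Proof. by have := jmul_linearl z 1 x y; rewrite !scale1r. Qed.

Lemma jmulZl (F : numFieldType) (A : jordanAlgebra F) c (x z : A) :
  jmul (c *: x) z = c *: jmul x z.
Proof. by have := jmul_linearl z c x 0; rewrite jmul0 !addr0. Qed.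

Lemma prod_null_plane (F : numFieldType) (A B : jordanAlgebra F) :
  has_null_plane B -> has_null_plane (prod_jordan A B).
Proof.
move=> [a [b [[aa ab bb] [a0 ba]]]]; exists (0, a), (0, b).
rewrite /= /prod_mul /= !jmul0 aa ab bb; split=> //; split=> [|c].
  by apply: contraNneq a0 => -[->].
by apply: contraNneq (ba c) => -[_ ->].
Qed.

Lemma E2_null_plane (F : numFieldType) : has_null_plane (E2_jordanAlgebra F).
Proof.
exists (basis4 F 2), (basis4 F 3); rewrite /=; split; last first.
  by split=> [|c]; [apply: basis4_neq0 | apply: basis4_indep].
by split; rewrite basis4_mul.
Qed.

Lemma E4_null_plane (F : numFieldType) : has_null_plane (E4_jordanAlgebra F).
Proof.
exists (basis4 F 2), (basis4 F 3); rewrite /=; split; last first.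
  by split=> [|c]; [apply: basis4_neq0 | apply: basis4_indep].
by split; rewrite basis4_mul.
Qed.

(** The isotropic vector [X + iZ] has square [Y - Y = 0]. *)
Lemma E3_null_plane (F : numFieldType) (i : F) :
  i * i = -1 -> has_null_plane (E3_jordanAlgebra F).
Proof.
move=> ii; pose A := E3_jordanAlgebra F.
have T k l : (k < 4)%N -> (l < 4)%N ->
    jmul (basis4 F k : A) (basis4 F l : A) = E3_table F k l by exact: basis4_mul.
exists (basis4 F 2 : A), ((basis4 F 1 : A) + i *: (basis4 F 3 : A)); split; last first.
  split=> [|c]; first exact: basis4_neq0.
  apply/eqP => /rowP/(_ 1)/eqP; rewrite !mxE /= !mulr0 addr0.
  by rewrite oner_eq0.
have M (k : nat) : (k < 4)%N ->
    jmul ((basis4 F 1 : A) + i *: (basis4 F 3 : A)) (basis4 F k : A) =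
    E3_table F 1 k + i *: E3_table F 3 k.
  by move=> k4; rewrite jmulDl jmulZl !T.
split; first exact: T.
  by rewrite jmulC M //= scaler0 addr0.
rewrite jmulDl jmulZl [jmul (basis4 F 1 : A) _]jmulC [jmul (basis4 F 3 : A) _]jmulC.
rewrite !M //= scaler0 add0r addr0 scalerA ii.
by rewrite scaleN1r subrr.
Qed.

(** * The algebra with [W^2 = V] *)

Definition cols (F : Type) (m n : nat) (p : 'I_n -> 'cV[F]_m) : 'M[F]_(m, n) :=
  \matrix_(i, j) p j i 0.

Lemma mulmx_cols (F : nzRingType) (l m n : nat) (A : 'M[F]_(l, m))
    (p : 'I_n -> 'cV[F]_m) : A *m cols p = cols (fun j => A *m p j).
Proof.
by apply/matrixP => i j; rewrite !mxE; apply: eq_bigr => k _; rewrite !mxE.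
Qed.

Lemma gram_cols (F : comNzRingType) (m n : nat) (A : 'M[F]_m)
    (p : 'I_n -> 'cV[F]_m) i j :
  ((cols p)^T *m A *m cols p) i j = ((p i)^T *m A *m p j) 0 0.
Proof.
rewrite mulmx_cols mxE !mxE; apply: eq_bigr => k _; rewrite !mxE.
by congr (_ * _); apply: eq_bigr => l _; rewrite !mxE.
Qed.

Lemma E1_3_mxZ (F : numFieldType) (k v w x y : F) :
  k *: E1_3_mx v w x y = E1_3_mx (k * v) (k * w) (k * x) (k * y).
Proof.
by apply/matrixP => -[[|[|[|//]]] ?] -[[|[|[|//]]] ?]; rewrite !mxE //= mulr0.
Qed.

(** [E1_3_mx 0 0 1 1] is the antidiagonal unit matrix; multiplying
    [E1_3_mx v w x y] by it on the right gives the upper triangular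
    matrix of the operator in the basis [N^2 t, N t, t].  The vector [t] is
    [A s - c *: B s], where [s] is any vector with [s^T K B s] nonzero. *)
Lemma E1_adapted_frame (F : numFieldType) (K A B N : 'M[F]_3) :
  K^T = K -> (K *m B)^T = K *m B -> (K *m A)^T = K *m A -> (K *m N)^T = K *m N ->
  K *m B != 0 ->
  A *m A = A -> A *m B + B *m A = 2 *: B -> A *m N + N *m A = N ->
  N *m N = B -> B *m N + N *m B = 0 -> B *m B = 0 ->
  exists (Q : 'M[F]_3) (k : F),
    [/\ k != 0, Q^T *m K *m Q = k *: E1_3_mx 0 0 1 1 &
    forall x y v w, (x *: A + y *: (1%:M - A) + v *: B + w *: N) *m Q
      = Q *m E1_3_mx v w x y *m E1_3_mx 0 0 1 1].
Proof.
move=> Ks KBs KAs KNs KB0 AA ABA AN_NA NN BN_NB BB.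
have two : 2 != 0 :> F by rewrite pnatr_eq0.
(* Peirce relations: multiply the anticommutation rules by A on either side *)
have ABA1 : A *m B *m A = A *m B.
  apply: (addrI (A *m B)); have := congr1 (mulmx A) ABA.
  by rewrite mulmxDr !mulmxA AA -scalemxAr scaler_nat mulr2n.
have ABA2 : A *m B *m A = B *m A.
  apply: (addIr (B *m A)); have := congr1 (mulmx^~ A) ABA.
  by rewrite mulmxDl -!mulmxA AA -scalemxAl scaler_nat mulr2n.
have AB : A *m B = B.
  have := ABA; rewrite -ABA2 ABA1 -mulr2n -scaler_nat.
  exact: scalerI.
have BA : B *m A = B by rewrite -ABA2 ABA1.
have ANA : A *m N *m A = 0.
  apply: (addrI (A *m N)); have := congr1 (mulmx A) AN_NA.
  by rewrite mulmxDr !mulmxA AA addr0.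
(* N and B = N^2 commute, so their anticommutator is 2 N B *)
have NB : N *m B = 0.
  have := BN_NB; rewrite -{1}NN -mulmxA NN -mulr2n -scaler_nat => /eqP.
  by rewrite scaler_eq0 (negbTE two) => /eqP.
have BN : B *m N = 0 by rewrite -NN -mulmxA NN.
have [s s0] := sym_form_neq0 KBs KB0.
set k := (_ *m _) 0 0 in s0.
(* the value of c that makes the last frame vector isotropic *)
pose c := (s^T *m (K *m A) *m s) 0 0 / (2 * k).
(* o lists the operators carrying s to the frame, o' their adjoints *)
pose o : seq 'M[F]_3 := [:: B; N *m A; A - c *: B].
pose o' : seq 'M[F]_3 := [:: B; A *m N; A - c *: B].
pose p (j : 'I_3) := nth 0 o j *m s.
have adj (i j : 'I_3) :
    (p i)^T *m K *m p j = s^T *m (K *m (nth 0 o' i *m nth 0 o j)) *m s.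
  have Ko C : (K *m C)^T = K *m C -> C^T *m K = K *m C.
    by rewrite trmx_mul Ks.
  have {}Ko : (nth 0 o i)^T *m K = K *m nth 0 o' i.
    case: i => -[|[|[|//]]] ? /=; first exact: Ko.
      by rewrite trmx_mul -mulmxA Ko // !mulmxA Ko.
    by rewrite linearB linearZ /= mulmxBl mulmxBr -scalemxAl -scalemxAr !Ko.
  by rewrite trmx_mul -!mulmxA (mulmxA _ K) Ko !mulmxA.
have prodE (i j : 'I_3) : nth 0 o' i *m nth 0 o j =
    nth 0 (nth [::] [:: [:: 0; 0; B]; [:: 0; B; 0]; [:: B; 0; A - (2 * c) *: B]] i) j.
  case: i => -[|[|[|//]]] hi; case: j => -[|[|[|//]]] hj /=;
    rewrite ?(mulmxBl, mulmxBr) -?(scalemxAl, scalemxAr) ?mulmxA;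
    rewrite ?(AA, BB, AB, BA, NB, BN, ANA) ?mul0mx ?scaler0 ?subr0 //.
  - by rewrite -mulmxA NB mulmx0.
  - by rewrite -(mulmxA A) NN AB BA.
  - by rewrite -mulmxA NB mulmx0 scaler0 subr0.
  - by rewrite -addrA -opprD -scalerDl -mulr2n mulr_natl.
exists (cols p), k; split=> //.
  apply/matrixP => i j; rewrite gram_cols adj prodE.
  have q0 : (s^T *m (K *m 0) *m s) 0 0 = 0 by rewrite !mulmx0 mul0mx mxE.
  have qc : (s^T *m (K *m (A - (2 * c) *: B)) *m s) 0 0 = 0.
    rewrite mulmxBr -scalemxAr mulmxBr mulmxBl -scalemxAr -scalemxAl mxE.
    rewrite [X in _ + X]mxE [X in _ - X]mxE -/k /c; field.
    by rewrite s0.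
  case: i => -[|[|[|//]]] hi; case: j => -[|[|[|//]]] hj;
    by rewrite /= [RHS]mxE [in RHS]mxE /= ?q0 ?qc ?mulr0 ?mulr1.
move=> x y v w; rewrite mulmx_cols.
have actE (j : 'I_3) : (x *: A + y *: (1%:M - A) + v *: B + w *: N) *m nth 0 o j =
    nth 0 [:: x *: B; y *: (N *m A) + w *: B;
           x *: (A - c *: B) + w *: (N *m A) + v *: B] j.
  rewrite !mulmxDl -!scalemxAl mulmxBl mul1mx.
  case: j => -[|[|[|//]]] hj /=;
    rewrite ?(mulmxBl, mulmxBr) -?(scalemxAl, scalemxAr) ?mulmxA;
    rewrite ?(AA, BB, AB, BA, NB, BN, ANA, NN) ?mul0mx;
    rewrite ?(scaler0, subr0, subrr, addr0, add0r) //.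
  by rewrite addrAC.
apply/matrixP => i j; rewrite mxE [p j]/p mulmxA actE.
have pE l : cols p i l = (p l) i 0 by rewrite mxE.
rewrite -mulmxA [RHS]mxE.
under eq_bigr => l _ do rewrite pE /p [(_ *m _) l j]mxE.
rewrite !big_ord_recl !big_ord0 /=.
move: (A - c *: B) => C.
by case: j => -[|[|[|//]]] hj; rewrite /= ?mulmxDl -?scalemxAl;
  move: (B *m s) (N *m A *m s) (C *m s) => b0 b1 b2; rewrite !mxE /=; ring.
Qed.

(** The relations required of [X], [V], [W] are those that the table imposes on
    the images of the basis, with every product doubled to avoid the factor 1/2. *)
Lemma E1_normal_form (F : numFieldType) (U X Y V W : 'M[F]_3) (K := invmx U) :
  U \in unitmx -> U^T = U -> X^T = X -> V^T = V -> W^T = W -> V != 0 -> X + Y = U ->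
  X *m K *m X + X *m K *m X = 2 *: X -> X *m K *m V + V *m K *m X = 2 *: V ->
  X *m K *m W + W *m K *m X = W -> W *m K *m W + W *m K *m W = 2 *: V ->
  V *m K *m W + W *m K *m V = 0 -> V *m K *m V + V *m K *m V = 0 ->
  exists (Q : 'M[F]_3) (k : F), [/\ Q \in unitmx, k != 0 &
    forall x y v w, x *: X + y *: Y + v *: V + w *: W
      = Q *m (k *: E1_3_mx v w x y) *m Q^T].
Proof.
move=> Uu Us Xs Vs Ws V0 XY XX XV XW WW VW VV.
have Ks : K^T = K by rewrite trmx_inv Us.
have adj Z : Z^T = Z -> (K *m (Z *m K))^T = K *m (Z *m K).
  by move=> Zs; rewrite !trmx_mul Ks Zs mulmxA.
have half Z Z' : Z + Z = 2 *: Z' -> Z = Z' :> 'M[F]_3.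
  rewrite -mulr2n -scaler_nat; apply: scalerI; by rewrite pnatr_eq0.
have toK Z1 Z2 Z3 : Z1 = Z2 -> Z1 *m Z3 = Z2 *m Z3 :> 'M[F]_3 by move->.
have KU : K *m U = 1%:M by rewrite mulVmx.
have [||||||||||Q [k [k0 QKQ act]]] :=
  @E1_adapted_frame F K (X *m K) (V *m K) (W *m K) Ks.
- exact: adj.
- exact: adj.
- exact: adj.
- apply: contraNneq V0 => KVK.
  have -> : V = U *m (K *m (V *m K)) *m U.
    by rewrite mulmxA mulmxV // mul1mx -mulmxA KU mulmx1.
  by rewrite KVK mulmx0 mul0mx.
- by rewrite mulmxA (half _ _ XX).
- by rewrite !mulmxA -mulmxDl XV scalemxAl.
- by rewrite !mulmxA -mulmxDl XW.
- by rewrite mulmxA (half _ _ WW).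
- by rewrite !mulmxA -mulmxDl VW mul0mx.
- have -> : V *m K *m (V *m K) = 0; last by [].
  have VV0 : V *m K *m V = 0 by apply: half; rewrite VV scaler0.
  by rewrite mulmxA VV0 mul0mx.
set J := E1_3_mx 0 0 1 1 in QKQ act.
have JJ : J *m J = 1%:M.
  apply/matrixP => i j; rewrite mxE !big_ord_recl big_ord0 !mxE.
  by case: i => -[|[|[|//]]] hi; case: j => -[|[|[|//]]] hj; rewrite /=; ring.
have QQ : (k^-1 *: (J *m Q^T *m K)) *m Q = 1%:M.
  rewrite -scalemxAl -!mulmxA (mulmxA Q^T) QKQ -scalemxAr JJ scalerA mulVf //.
  by rewrite scale1r.
have [_ Qu] := mulmx1_unit QQ.
(* invert the Gram relation Q^T K Q = k J *)
have UE : U = Q *m (k^-1 *: J) *m Q^T.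
  move/mulmx1C/toK: QQ => /(_ U).
  rewrite mul1mx -scalemxAr -scalemxAl -!mulmxA KU mulmx1 => UE.
  by rewrite -[LHS]UE scalemxAr scalemxAl mulmxA.
exists Q, k^-1; split=> //; first by rewrite invr_eq0.
move=> x y v w; rewrite [LHS](_ : _ =
  (x *: (X *m K) + y *: (1%:M - X *m K) + v *: (V *m K) + w *: (W *m K)) *m U).
    rewrite UE !mulmxA act -(mulmxA _ J) -scalemxAr JJ.
  by rewrite -!(scalemxAr, scalemxAl) mulmx1.
rewrite !mulmxDl -!scalemxAl mulmxBl -!mulmxA KU !mulmx1 mul1mx.
by rewrite -XY [X + Y]addrC addrK.
Qed.

Lemma E1_embedding_congruent (F : numFieldType) (L : set 'M[F]_3) :
  is_embedding (E1_jordanAlgebra F) L -> congruent L (E1_3 F).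
Proof.
move=> /embeddingP[U [g [[Uu Us g1] ginj gs gM ->]]].
have b i (hi : (i < 4)%N) j (hj : (j < 4)%N) :
    g (basis4 F i) *m invmx U *m g (basis4 F j)
    + g (basis4 F j) *m invmx U *m g (basis4 F i)
    = 2 *: g (E1_table F i j).
  by rewrite gM /= basis4_mul.
have two2 (M : 'M[F]_3) : 2 *: (2^-1 *: M) = M.
  by rewrite scalerA mulfV ?pnatr_eq0 // scale1r.
have [|||||Q [k [Qu k0 gE]]] := @E1_normal_form F U (g (basis4 F 0)) (g (basis4 F 1))
  (g (basis4 F 2)) (g (basis4 F 3)) Uu Us (gs _) (gs _) (gs _) _ _
  (b 0 isT 0 isT) (b 0 isT 2 isT) _ (b 3 isT 3 isT) _ _.
- rewrite -[X in _ != X](linear0 g) (inj_eq ginj); exact: basis4_neq0.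
- by rewrite -linearD -g1.
- by rewrite (b 0 isT 3 isT) linearZ two2.
- by rewrite (b 2 isT 3 isT) linear0 scaler0.
- by rewrite (b 2 isT 2 isT) linear0 scaler0.
have {}gE (a : 'rV[F]_4) :
    g a = Q *m (k *: E1_3_mx (a 0 2) (a 0 3) (a 0 0) (a 0 1)) *m Q^T.
  by rewrite -gE -!linearZ -!linearD; congr (g _); apply/basis4_expansion.
have PE (a : 'rV[F]_4) : invmx Q *m g a *m (invmx Q)^T
    = k *: E1_3_mx (a 0 2) (a 0 3) (a 0 0) (a 0 1).
  by rewrite gE !mulmxA mulVmx // mul1mx -mulmxA -trmx_mul mulVmx // trmx1 mulmx1.
exists (invmx Q); first by rewrite unitmx_inv.
apply/seteqP; split=> [M [v [w [x [y ->]]]]|M [_ [a _ <-] <-]] /=.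
  pose a : 'rV[F]_4 := \row_i nth 0 [:: k^-1 * x; k^-1 * y; k^-1 * v; k^-1 * w] i.
  exists (g a); first by exists a.
  by rewrite PE !mxE /= E1_3_mxZ !mulVKf.
rewrite PE E1_3_mxZ; do 4 eexists; reflexivity.
Qed.

(** * Embeddings into 3x3 symmetric matrices *)

Theorem proposition3p6 (R : realType) :
  (forall L : set 'M[R[i]]_3, ~ is_embedding (spin_jordan R[i] 3 1) L) /\
  (forall L : set 'M[R[i]]_3,
     ~ is_embedding (prod_jordan (base_jordan R[i]) (spin_jordan R[i] 2 0)) L) /\
  (forall L : set 'M[R[i]]_3, ~ is_embedding (E2_jordanAlgebra R[i]) L) /\
  (forall L : set 'M[R[i]]_3, ~ is_embedding (E3_jordanAlgebra R[i]) L) /\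
  (forall L : set 'M[R[i]]_3, ~ is_embedding (E4_jordanAlgebra R[i]) L) /\
  (forall L : set 'M[R[i]]_3, ~ is_embedding (spin_jordan R[i] 3 0) L) /\
  (forall L : set 'M[R[i]]_3,
     is_embedding (E1_jordanAlgebra R[i]) L -> congruent L (E1_3 R[i])).
Proof.
split=> [L|]; first exact/null_plane_no_embedding/spin_null_plane.
split=> [L|].
  exact/null_plane_no_embedding/prod_null_plane/spin_null_plane.
split=> [L|]; first exact/null_plane_no_embedding/E2_null_plane.
split=> [L|].
  apply/null_plane_no_embedding/(E3_null_plane (i := 'i)).
  by rewrite -expr2 sqrCi.
split=> [L|]; first exact/null_plane_no_embedding/E4_null_plane.
split=> [L|]; first exact/null_plane_no_embedding/spin_null_plane.
exact: E1_embedding_congruent.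
Qed.
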